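(* Let $\epsilon>0$, and let $c$ be a constant with $0<c<1/2$ having the following property: with $Q=Q(N)=c\log N\log\log N$ and $f$ a $Q$-multiplicative random function on $\mathbb{Z}/N\mathbb{Z}$, for every $\epsilon'>0$ one has $\mathbb{P}((2-\epsilon')\log N\leq \omega(\Gamma_f)\leq (2+\epsilon')\log N)=1-o(1)$ as $N\to\infty$ through the primes. For each (sufficiently large) prime $N$ sample a random graph $\Gamma_f^{(N)}$ on $\mathbb{Z}/N\mathbb{Z}$, generated by a $Q(N)$-multiplicative random function, independently for different $N$. Then, almost surely, both of the following hold: (i) $\omega(\Gamma_f^{(N)})\geq Q(N)/2$ for infinitely many primes $N$; (ii) the set of primes $N$ for which $(2-\epsilon)\log N\leq\omega(\Gamma_f^{(N)})\leq(2+\epsilon)\log N$ has relative density in the primes equal to $1$.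
   Context: All logarithms are to base $2$. For real $Q\ge 1$, $[1,Q]$ denotes the set of integers $n$ with $1\le n\le Q$, and also its image in $\mathbb{Z}/N\mathbb{Z}$ (elements of $\mathbb{Z}/N\mathbb{Z}$ are identified with integers in the obvious way). A $Q$-multiplicative random function is the random function $f\colon \mathbb{Z}/N\mathbb{Z}\to\{-1,1\}$ defined as follows: for every prime number $p\in[1,Q]$, $f(p)$ is a uniform $\pm1$ random variable, all these being independent; $f$ is then extended to be completely multiplicative on $[1,Q]$ (so $f(n)=\prod_p f(p)^{v_p(n)}$ for $n\in[1,Q]$, where $v_p(n)$ is the exponent of $p$ in $n$, and $f(1)=1$); finally, for each $x\in\mathbb{Z}/N\mathbb{Z}$ not in $[1,Q]$, $f(x)$ is a uniform $\pm 1$ random variable, independent of all other choices. The graph $\Gamma_f$ generated by $f$ has vertex set $\mathbb{Z}/N\mathbb{Z}$, and distinct vertices $x\neq y$ are joined by an edge if and only if $f(x+y)=1$. $\omega(\Gamma)$ denotes the clique number of a graph $\Gamma$, i.e. the number of vertices of its largest complete subgraph. The relative density in the primes of a set $R$ of primes is $\lim_{M\to\infty}|R\cap[1,M]|/\pi(M)$ (if the limit exists), where $\pi(M)$ is the number of primes up to $M$. *)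

(* Defs.v *)
From HB Require Import structures.
From mathcomp Require Export all_boot all_order all_algebra finmap.
From mathcomp Require Export all_classical all_reals all_analysis.
Export Order.TTheory GRing.Theory Num.Theory.
Export numFieldNormedType.Exports.

Set Implicit Arguments.
Unset Strict Implicit.
Unset Printing Implicit Defensive.

Local Open Scope classical_set_scope.
Local Open Scope ring_scope.

Definition log2 (R : realType) (x : R) : R := ln x / ln 2.

(* For the few primes N with Q N < 1, the set [1, Q N] is simply empty. *)
Definition Qof (R : realType) (c : R) (N : nat) : R :=
  c * log2 N%:R * log2 (log2 N%:R).

(* Mutual independence of the set systems E i, i in D; to be applied to the
   sigma-algebras generated by random variables. *)
Definition mutually_independent (d : measure_display) (T : measurableType d)
    (R : realType) (P : probability T R) (I : choiceType) (D : set I)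
    (E : I -> set (set T)) : Prop :=
  forall (J : {fset I}) (A : I -> set T),
    [set` J] `<=` D -> (forall i, i \in J -> E i (A i)) ->
    P (\bigcap_(i in [set` J]) A i) = (\prod_(i <- J) P (A i))%E.

Definition gen_by (T : Type) (d : measure_display) (U : measurableType d)
    (X : T -> U) : set (set T) :=
  preimage_set_system [set: T] X measurable.

(* The same for a variable whose values carry the discrete sigma-algebra. *)
Definition gen_by_discrete (T U : Type) (X : T -> U) : set (set T) :=
  preimage_set_system [set: T] X [set: set U].

Definition uniform_sign (d : measure_display) (T : measurableType d)
    (R : realType) (P : probability T R) (X : T -> R) : Prop :=
  P (X @^-1` [set 1]) = (2^-1)%:E /\ P (X @^-1` [set -1]) = (2^-1)%:E.

(* The image of [1, Q] in Z/NZ, for Q < N, through representatives in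
   {0, ..., N-1}. *)
Definition in_1Q (R : realType) (Q : R) (N : nat) (x : 'Z_N) : bool :=
  (0 < (x : nat))%N && ((x : nat)%:R <= Q).

(* The points at which the value of f is chosen freely. *)
Definition free_point (R : realType) (Q : R) (N : nat) (x : 'Z_N) : bool :=
  ~~ in_1Q Q x || prime x.

(* Meant for 1 < N (so that 'Z_N is Z/NZ) and Q < N. *)
Record Qmultiplicative (R : realType) (Q : R) (N : nat) (d : measure_display)
    (T : measurableType d) (P : probability T R)
    (f : 'Z_N -> {RV P >-> R}) : Prop := {
  Qmult_sign : forall x w, f x w = 1 \/ f x w = -1 ;
  Qmult_mul : forall (x : 'Z_N) w, in_1Q Q x ->
    f x w = \prod_(p <- primes x) f p%:R w ^+ logn p x ;
  Qmult_uniform : forall x, free_point Q x -> uniform_sign P (f x) ;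
  Qmult_indep : mutually_independent P [set x | free_point Q x]
    (fun x => gen_by (f x)) }.

(* The graph generated by g, as its adjacency relation. *)
Definition sum_graph (R : realType) (N : nat) (g : 'Z_N -> R) : rel 'Z_N :=
  fun x y => (x != y) && (g (x + y) == 1).

Definition is_clique (V : finType) (e : rel V) (S : {set V}) : bool :=
  [forall x in S, forall y in S, (x != y) ==> e x y].

Definition clique_number (V : finType) (e : rel V) : nat :=
  \max_(S : {set V} | is_clique e S) #|S|.

Definition random_graph (R : realType) (N : nat) (d : measure_display)
    (T : measurableType d) (P : probability T R) (f : 'Z_N -> {RV P >-> R})
    (w : T) : rel 'Z_N :=
  sum_graph (fun x => f x w).

Definition clique_near_2log (R : realType) (eps : R) (N : nat)
    (e : rel 'Z_N) : bool :=
  (2 - eps) * log2 N%:R <= (clique_number e)%:R <= (2 + eps) * log2 N%:R.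

(* The property required of c. The probability below depends only on the law
   of f N, hence only on N; accordingly the statement ranges over all
   realizations, on probability spaces that may vary with N. *)
Definition clique_concentration (R : realType) (c : R) : Prop :=
  forall (d : nat -> measure_display) (T : forall N, measurableType (d N))
    (P : forall N, probability (T N) R)
    (f : forall N, 'Z_N -> {RV (P N) >-> R}) (N0 : nat),
    (forall N, (N0 <= N)%N -> prime N -> Qmultiplicative (Qof c N) (f N)) ->
    forall eps : R, 0 < eps ->
      P N [set w | clique_near_2log eps (random_graph (f N) w)]
        @[N --> within [set N | prime N] \oo] --> (1%:E : \bar R).

Definition prime_count (A : pred nat) (M : nat) : nat :=
  #|[pred p : 'I_M.+1 | prime p && A p]|.

Definition relative_density_in_primes (R : realType) (A : pred nat) (l : R)
    : Prop :=
  ((prime_count A M)%:R / (prime_count predT M)%:R : R) @[M --> \oo] --> l.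

(* Main.v *)
Require Import Defs.
From mathcomp Require Import zify lra.

(** Only two events about each graph matter, and since the graphs are
    independent, Borel-Cantelli arguments decide how often they occur.

    Infinitely many large cliques. If f(p) = 1 for every prime p <= Q, then
    f = 1 on all of [1, Q], and {0, ..., floor(Q/2)} is a clique. This happens
    with probability at least 2^(-pi(Q)). For M = 2^k with k = 2^j one has
    Q(M) = c k log k, and Chebyshev's bound pi(x) <= (2 + o(1)) x / log x gives
    pi(Q(M)) <= (2c + o(1)) k with 2c < 1. As Q is nondecreasing, each prime
    N <= M has a large clique with probability at least M^(-2c - o(1)), and
    Chebyshev's lower bound provides about M / log M such primes. So the sum
    of the probabilities diverges, and the second Borel-Cantelli lemma
    [infinitely_often] applies. The arithmetic input is
    [many_primes_versus_Qof]; the exponent 2c is where c < 1/2 comes from, the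
    constant 2 being the base-2 logarithm of the 4 in the bound
    prod_(p <= n) p <= 4^n [primorial_le].

    Density one. By hypothesis the probability that the clique number of the
    N-th graph is far from 2 log N tends to 0. A law of large numbers for
    independent events of vanishing probability [rare_events] then says that
    almost surely the proportion of such N among the primes tends to 0. It
    rests on an exponential-moment bound: leaving aside finitely many primes that
    depend on L, the chance that at least a fraction 1/L of the first n primes
    is exceptional is at most (3/4)^n. This is summable, so the first
    Borel-Cantelli lemma applies for each L. *)

Set Implicit Arguments.
Unset Strict Implicit.
Unset Printing Implicit Defensive.

Local Open Scope classical_set_scope.
Local Open Scope ring_scope.

(** * Counting functions *)

Section counting.
Local Open Scope nat_scope.

Definition counting (D : pred nat) (M : nat) : nat := \sum_(i < M.+1) D i.

Lemma countingS D M : counting D M.+1 = counting D M + D M.+1.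
Proof. by rewrite /counting big_ord_recr. Qed.

Lemma leq_counting D : {homo counting D : m n / m <= n}.
Proof.
by apply: homo_leq (leqnn) leq_trans _ => n; rewrite countingS leq_addr.
Qed.

Lemma countingE D M : counting D M = size [seq i <- iota 0 M.+1 | D i].
Proof.
rewrite size_filter /counting -(big_mkord predT (fun i => D i : nat)).
rewrite /index_iota subn0 -sum1_count [RHS]big_mkcond.
by apply: eq_bigr => i _; case: (D i).
Qed.

Lemma counting_infty (D : pred nat) :
  (forall n, exists2 N, n <= N & D N) ->
  forall K, exists M0, forall M, M0 <= M -> K <= counting D M.
Proof.
move=> infD; elim=> [|K [M0 IH]]; first by exists 0.
have [N M0N DN] := infD M0.+1; exists N; elim=> [|M IHM] NM.
  by move: NM M0N; lia.
rewrite countingS; move: NM; rewrite leq_eqVlt => /orP[/eqP NE|NM].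
  by rewrite -NE DN addn1 ltnS IH //; lia.
by apply: leq_trans (IHM _) (leq_addr _ _); lia.
Qed.

(** Altering a set of integers below n changes its counting function by at most
    n, so finitely many indices never matter for a density. *)
Lemma counting_split (D D' : pred nat) n M :
  (forall i, n <= i -> D i -> D' i) ->
  counting D M <= counting D' M + n.
Proof.
move=> h; suff : (counting D M <= counting D' M + minn n M.+1) by lia.
elim: M => [|M IH].
  rewrite /counting !big_ord1; case: (posnP n) => [n0|n0].
    by have := h 0; rewrite n0; case: (D _) => //= ->.
  by case: (D _); case: (D' _); lia.
rewrite !countingS; have := h M.+1.
have [nM|Mn] := leqP n M.+1.
  by case: (D _) => [->|] //; lia.
by case: (D _); case: (D' _); lia.
Qed.

End counting.

(** * Chebyshev's bounds for the number of primes *)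

Section chebyshev.
Local Open Scope nat_scope.

(** Distinct primes are pairwise coprime, so divisibility can be checked one
    prime at a time. *)
Lemma prod_primes_dvd a b X :
  (forall p, a <= p < b -> prime p -> p %| X) ->
  \prod_(a <= p < b | prime p) p %| X.
Proof.
elim: b => [|b IH] hX; first by rewrite big_geq // dvd1n.
have [hab|hba] := leqP a b; last by rewrite big_geq ?dvd1n //; lia.
have IHb : \prod_(a <= p < b | prime p) p %| X.
  by apply: IH => p hp; apply: hX; lia.
rewrite big_mkcond big_nat_recr //= -big_mkcond /=.
case: ifP => [pb|_]; last by rewrite muln1.
rewrite Gauss_dvd; first by rewrite IHb hX //; lia.
rewrite coprime_sym prime_coprime //.
rewrite big_nat_cond.
apply/negP; elim/big_ind : _ => [|x y hx hy|p /andP[hp pp]].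
- by rewrite dvdn1 => /eqP b1; rewrite b1 in pb.
- by rewrite Euclid_dvdM // => /orP[].
- by rewrite dvdn_prime2 // => /eqP; lia.
Qed.

Lemma prime_dvd_fact p n : prime p -> p %| n`! -> p <= n.
Proof.
move=> pp; elim: n => [|n IH]; first by rewrite fact0 Euclid_dvd1.
by rewrite factS Euclid_dvdM // => /orP[/dvdn_leq ->|/IH /leqW].
Qed.

Definition primorial n := \prod_(0 <= p < n.+1 | prime p) p.

(** The binomial coefficient occurs twice in the expansion of (1 + 1)^(2m+1),
    as the entries m and m + 1. *)
Lemma bin_middle_le m : 'C(m.*2.+1, m) <= 4 ^ m.
Proof.
have e0 : m.*2.+1 - m.+1 = m by lia.
have h : 'C(m.*2.+1, m) + 'C(m.*2.+1, m.+1) <= 2 ^ m.*2.+1.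
  rewrite -[2]/(1 + 1) expnDn.
  have lm : m < m.*2.+2 by lia.
  have lm1 : m.+1 < m.*2.+2 by lia.
  rewrite (bigD1 (Ordinal lm)) //= (bigD1 (Ordinal lm1)) /=; last first.
    by rewrite -val_eqE /=; lia.
  by rewrite !exp1n !muln1 addnA leq_addr.
have e : 'C(m.*2.+1, m.+1) = 'C(m.*2.+1, m).
  have := @bin_sub m.*2.+1 m.+1 ltac:(lia).
  by rewrite e0.
by move: h; rewrite e expnS -(mul2n m) expnM addnn -mul2n leq_mul2l.
Qed.

(** Erdos' argument, by strong induction. For n = 2m + 1 the primes in
    (m + 1, 2m + 1] all divide the binomial coefficient 'C(2m+1, m) <= 4^m, and
    the induction hypothesis for m + 1 covers the others. An even n > 2 is not
    prime, so it adds no factor. *)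
Lemma primorial_le n : primorial n <= 4 ^ n.
Proof.
elim/ltn_ind: n => -[|[|n]] IH; rewrite /primorial.
- by rewrite unlock.
- by rewrite unlock.
have [on|en] := boolP (odd n).
- set m := n./2.+1; have nE : n.+2 = m.*2.+1 by rewrite /m; lia.
  clearbody m; rewrite nE (@big_cat_nat _ _ _ m.+2) //=; last by lia.
  have -> : 4 ^ m.*2.+1 = 4 ^ m.+1 * 4 ^ m by rewrite -expnD; congr (_ ^ _); lia.
  apply: leq_mul; first by apply: IH; lia.
  apply: leq_trans (bin_middle_le m); apply: dvdn_leq.
    by rewrite bin_gt0; lia.
  apply: prod_primes_dvd => p hp pp.
  have := @bin_fact m.*2.+1 m; rewrite (_ : _ - m = m.+1); last by lia.
  move=> /(_ ltac:(lia)) h.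
  have : p %| (m.*2.+1)`! by rewrite dvdn_fact //; lia.
  rewrite -h 2?Euclid_dvdM // => /orP[//|].
  by case/orP => /(prime_dvd_fact pp) ?; lia.
- rewrite big_mkcond big_nat_recr //= -big_mkcond /=.
  case: ifP => [pn|_].
    case: (even_prime pn) => [->|]; last by rewrite /= negbK (negbTE en).
    by rewrite expnS mulnC leq_mul // IH.
  rewrite muln1; apply: leq_trans (IH n.+1 _) _; first by lia.
  by rewrite leq_exp2l.
Qed.

Lemma counting_prime_le n : counting prime n <= n.
Proof.
elim: n => [|n IH]; first by rewrite /counting big_ord1.
by rewrite countingS; case: (prime n.+1); lia.
Qed.

(** The bound pi(n) <= 2^i + 2n / i: each prime above 2^i contributes a factor
    at least 2^i to the primorial. The threshold 2^i is free here; taking it a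
    constant factor below log N is what keeps the constant 2 in front of
    n / log n. *)
Lemma counting_prime_upper i n : i * (counting prime n - 2 ^ i) <= n.*2.
Proof.
suff h : 2 ^ (i * (counting prime n - 2 ^ i)) <= primorial n.
  rewrite -(@leq_exp2l 2) //; apply: leq_trans h _.
  by apply: leq_trans (primorial_le n) _; rewrite -mul2n expnM.
elim: n => [|n IH].
  rewrite (_ : _ - _ = 0); last by have := counting_prime_le 0; lia.
  by rewrite muln0 /primorial unlock.
rewrite countingS /primorial big_mkcond big_nat_recr //= -big_mkcond /=.
case: ifP => _; last by rewrite addn0 muln1.
have [lt|ge] := leqP (2 ^ i) (counting prime n); last first.
  rewrite (_ : _ - _ = 0) ?muln0; last lia.
  by rewrite muln_gt0 andbT; apply: leq_trans IH; rewrite expn_gt0.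
rewrite (_ : _ - _ = (counting prime n - 2 ^ i).+1); last lia.
rewrite mulnS expnD mulnC leq_mul //.
by apply: leq_trans lt _; apply: leq_trans (counting_prime_le n) _.
Qed.

(** From the recursion
    (n + 1) 'C(2n+2, n+1) = 2 (2n + 1) 'C(2n, n). *)
Lemma bin_central_ge n : 0 < n -> 4 ^ n <= n.*2 * 'C(n.*2, n).
Proof.
case: n => // n _; elim: n => [|n IH]; first by rewrite bin1.
set m := n.+1 in IH *.
have e1 := mul_bin_diag (m.*2.+2) m.
have e2 := mul_bin_diag (m.*2.+1) m.
have e3 : 'C(m.*2.+1, m.+1) = 'C(m.*2.+1, m).
  have := @bin_sub m.*2.+1 m.+1 ltac:(lia).
  by rewrite (_ : m.*2.+1 - m.+1 = m); last lia.
move: e1 e2; rewrite /= e3 doubleS => e1 e2.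
rewrite expnS; nia.
Qed.

(** By Legendre's formula the exponent of p in the central binomial
    coefficient is the sum over k of floor(2n / p^k) - 2 floor(n / p^k); each
    term is at most 1, and it is 0 as soon as p^k > 2n. *)
Lemma logn_central n p : prime p -> 0 < n ->
  p ^ logn p 'C(n.*2, n) <= n.*2.
Proof.
move=> pp n0; have p1 := prime_gt1 pp.
have hf : logn p (n.*2)`! = logn p 'C(n.*2, n) + (logn p n`!).*2.
  have := @bin_fact n.*2 n ltac:(lia); rewrite (_ : n.*2 - n = n); last lia.
  by move=> <-; rewrite !lognM ?muln_gt0 ?fact_gt0 ?bin_gt0 ?addnn //; lia.
have hn : logn p n`! = \sum_(1 <= k < n.*2.+1) n %/ p ^ k.
  rewrite logn_fact // [RHS](@big_cat_nat _ _ _ n.+1) //=; last lia.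
  rewrite [X in _ + X]big_nat_cond [X in _ + X]big1 ?addn0 // => k hk.
  by rewrite divn_small //; have := ltn_expl k p1; lia.
have h1 : logn p 'C(n.*2, n) <= \sum_(1 <= k < n.*2.+1) (p ^ k <= n.*2).
  rewrite -(leq_add2r (logn p n`!).*2) -hf logn_fact // hn.
  rewrite -[X in _ <= _ + X]mul2n big_distrr.
  rewrite -big_split; apply: leq_sum => k _ /=.
  have [h|h] := leqP (p ^ k) n.*2; last by rewrite divn_small.
  have := divn_eq n (p ^ k); have := divn_eq n.*2 (p ^ k).
  have pk : 0 < p ^ k by rewrite expn_gt0 prime_gt0.
  have := ltn_pmod n pk; have := ltn_pmod n.*2 pk.
  move: (p ^ k) (n %/ _) (n.*2 %/ _) (n %% _) (n.*2 %% _) => q a b r s.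
  nia.
suff h2 : logn p 'C(n.*2, n) <= trunc_log p n.*2.
  have n20 : 0 < n.*2 by lia.
  have /andP[h _] := trunc_log_bounds p1 n20.
  by apply: leq_trans h; rewrite leq_exp2l.
apply: leq_trans h1 _; set t := trunc_log p n.*2.
suff h : forall N, \sum_(1 <= k < N.+1) (p ^ k <= n.*2) <= minn t N.
  by apply: leq_trans (h _) _; rewrite geq_minl.
elim=> [|N IH]; first by rewrite big_geq.
rewrite big_nat_recr //=; move: IH; set S := (X in X <= minn t N) => IH.
case: (leqP (p ^ N.+1)) => [/(trunc_log_max p1)|_] /=; first by rewrite -/t; lia.
by rewrite addn0; lia.
Qed.

(** At 2n = 2^k: a central binomial coefficient is at least 4^n / 2n, and it is
    a product of at most pi(2n) prime powers, none of which exceeds 2n. *)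
Lemma counting_prime_lower k : 0 < k -> 2 ^ k <= k * (counting prime (2 ^ k)).+1.
Proof.
case: k => // k _; set n := 2 ^ k.
have n0 : 0 < n by rewrite expn_gt0.
have nE : 2 ^ k.+1 = n.*2 by rewrite expnS mul2n.
have C0 : 0 < 'C(n.*2, n) by rewrite bin_gt0; lia.
rewrite nE -(@leq_exp2l 2) // -nE expnM nE (_ : 2 ^ n.*2 = 4 ^ n); last first.
  by rewrite -mul2n expnM.
apply: leq_trans (bin_central_ge n0) _; rewrite expnS leq_mul //.
rewrite [X in X <= _]prod_prime_decomp // prime_decompE big_map /=.
rewrite big_seq.
apply: (@leq_trans (\prod_(p <- primes 'C(n.*2, n) | p \in primes 'C(n.*2, n))
                      n.*2)).
  apply: leq_prod => p; rewrite mem_primes => /and3P[pp _ _].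
  exact: logn_central.
rewrite -big_seq big_const_seq count_predT iter_muln_1 leq_exp2l; last lia.
rewrite countingE.
apply: uniq_leq_size (primes_uniq _) _ => p; rewrite mem_primes.
case/and3P => pp _ pC; rewrite mem_filter pp mem_iota /= add0n ltnS.
apply: (prime_dvd_fact pp).
by rewrite -(@bin_fact n.*2 n) ?dvdn_mulr //; lia.
Qed.

End chebyshev.

(** * Borel-Cantelli arguments for independent events *)

Lemma mutually_independent_seq (d : measure_display) (T : measurableType d)
    (R : realType) (P : probability T R) (I : choiceType) (D : set I)
    (E : I -> set (set T)) (A : I -> set T) (s : seq I) :
  mutually_independent P D E -> uniq s ->
  (forall i, i \in s -> D i) -> (forall i, i \in s -> E i (A i)) ->
  P (\big[setI/setT]_(i <- s) A i) = (\prod_(i <- s) P (A i))%E.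
Proof.
move=> ind us sD sE.
have mems i : (i \in seq_fset tt s) = (i \in s) by rewrite seq_fsetE.
have := ind (seq_fset tt s) A; rewrite -bigcap_seq.
have -> : [set` seq_fset tt s] = [set` s].
  by apply/seteqP; split => i /=; rewrite mems.
move=> -> //=; last by move=> i; rewrite mems; exact: sE.
apply: perm_big; have := seq_fset_perm tt s.
by rewrite undup_id.
Qed.

(** Bernoulli's inequality in the form (1 - u)^n <= 1 / (1 + n u), enough to make
    a product of 1 - u small when n u is large. *)
Lemma pow_one_minus_le (R : realType) (u : R) n : 0 <= u <= 1 ->
  (1 - u) ^+ n * (1 + n%:R * u) <= 1.
Proof.
move=> /andP[u0 u1]; elim: n => [|n IH]; first by rewrite expr0 mul0r addr0 mulr1.
apply: le_trans IH; rewrite exprSr -mulrA ler_wpM2l ?exprn_ge0 ?subr_ge0 //.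
rewrite -natr1; have : 0 <= (n%:R : R) by [].
nra.
Qed.

Section events.
Context (d : measure_display) (T : measurableType d) (R : realType)
        (P : probability T R).

Lemma union_bound (I : Type) (r : seq I) (Q : pred I) (A : I -> set T) :
  (forall i, measurable (A i)) ->
  (P (\big[setU/set0]_(i <- r | Q i) A i) <= \sum_(i <- r | Q i) P (A i))%E.
Proof.
move=> mA; elim: r => [|i r IH]; first by rewrite !big_nil measure0.
rewrite !big_cons; case: ifP => // _.
apply: le_trans (measureU2 _ _ _) _ => //; first exact: bigsetU_measurable.
by rewrite leeD2l.
Qed.

(** An exponential Markov inequality without expectations. If some J with Q J
    indexes only occurring events, the union bound costs the sum of the products
    of p over these J; weighting each J by a^|J| / t >= 1 and extending the sum
    to all J turns it into the expanded product of the 1 + a p_i. *)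
Lemma many_events_bound (I : finType) (A : I -> set T) (p : I -> R)
    (Q : pred {set I}) (a t : R) :
  (forall i, measurable (A i)) -> (forall i, 0 <= p i) ->
  (forall J : {set I},
     P (\big[setI/setT]_(i in J) A i) = (\prod_(i in J) p i)%:E) ->
  0 <= a -> 0 < t -> (forall J, Q J -> t <= a ^+ #|J|) ->
  (P (\big[setU/set0]_(J | Q J) \big[setI/setT]_(i in J) A i)
     <= ((\prod_i (1 + a * p i)) / t)%:E)%E.
Proof.
move=> mA p0 hA a0 t0 tQ.
apply: le_trans (union_bound _ _ _) _; first by move=> J; exact: bigsetI_measurable.
rewrite (eq_bigr _ (fun J _ => hA J)).
rewrite sumEFin lee_fin ler_pdivlMr //.
under [leRHS]eq_bigr do rewrite addrC.
rewrite bigA_distr mulr_suml big_mkcond /=; apply: ler_sum => J _.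
rewrite -big_mkcond /= big_split /= prodr_const.
case: ifPn => QJ; last by rewrite mulr_ge0 ?exprn_ge0 ?prodr_ge0.
by rewrite mulrC ler_wpM2r ?prodr_ge0 // tQ.
Qed.

(** Along the elements of D the counting function takes the values 1, 2, 3, and
    so on: this is a partial sum of a geometric series of sum 3. *)
Lemma geometric_counting (D : pred nat) n :
  \sum_(0 <= M < n) (if D M then (3 / 4 : R) ^+ counting D M else 0) <= 3.
Proof.
suff : \sum_(0 <= M < n) (if D M then (3 / 4 : R) ^+ counting D M else 0)
     = 3 - 3 * (if n is M.+1 then (3 / 4 : R) ^+ counting D M else 1).
  by move=> ->; rewrite gerBl mulr_ge0 //; case: n.
elim: n => [|n IH]; first by rewrite big_geq // mulr1 subrr.
rewrite big_nat_recr //= IH; case: n {IH} => [|n].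
  by rewrite /counting big_ord1; case: (D 0%N); lra.
rewrite countingS; case: (D n.+1); rewrite ?addn0 ?addn1 ?exprS; lra.
Qed.

(** Fix L. Once all probabilities are below 1/2 / 4^L, weighting the events by
    a = 4^L in [many_events_bound] bounds the probability that they occupy a
    fraction 1/(2L) of the n first elements of D by (3/2)^n / 2^n. Evaluating
    only at the elements of D makes these bounds summable without any
    information on the growth of D, and nothing changes between consecutive
    elements of D. The fraction 1/(2L) instead of 1/L leaves room for the
    finitely many indices of larger probability. *)
Lemma rare_events (D : pred nat) (A : nat -> set T) :
  (forall n, exists2 N, (n <= N)%N & D N) ->
  (forall i, D i -> measurable (A i)) ->
  (forall s : seq nat, uniq s -> (forall i, i \in s -> D i) ->
     P (\big[setI/setT]_(i <- s) A i) = (\prod_(i <- s) P (A i))%E) ->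
  (forall e : R, 0 < e -> exists n, forall i, (n <= i)%N -> D i ->
     (P (A i) <= e%:E)%E) ->
  forall L, {ae P, forall w, exists M0, forall M, (M0 <= M)%N ->
    (L * counting (fun i => D i && (w \in A i)) M <= counting D M)%N}.
Proof.
move=> infD mA indA smallA L.
(* The weight for which t = 2^n is at most a^|J| when n <= 2 L |J|. *)
pose a : R := 2 ^+ L.*2.
have a0 : 0 < a by rewrite exprn_gt0.
have [n1 hn1] := smallA (2^-1 / a) ltac:(by rewrite divr_gt0).
(* Discarding the other indices by emptying their events keeps the product
   rule valid for all finite index sets. *)
pose D' i := D i && (n1 <= i)%N.
pose A' i := if D' i then A i else set0.
pose p' i := fine (P (A' i)).
have mA' i : measurable (A' i).
  by rewrite /A' /D'; case: ifP => // /andP[/mA].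
have p'E i : P (A' i) = (p' i)%:E by rewrite fineK // fin_num_measure.
have p'0 i : 0 <= p' i by rewrite fine_ge0.
have indA' (s : seq nat) : uniq s ->
    P (\big[setI/setT]_(i <- s) A' i) = (\prod_(i <- s) p' i)%:E.
  move=> us; have [sD|] := boolP (all D' s).
    have sD' i : i \in s -> D' i by move/(allP sD).
    rewrite big_seq (eq_bigr A); last by move=> i /sD'; rewrite /A' => ->.
    rewrite -big_seq indA //; last by move=> i /sD' /andP[].
    rewrite -prodEFin big_seq [RHS]big_seq; apply: eq_bigr => i /sD' Di.
    by rewrite -p'E /A' Di.
  case/allPn => i si nDi.
  have Ai0 : A' i = set0 by rewrite /A' (negbTE nDi).
  rewrite (big_rem i) //= Ai0 set0I measure0 (big_rem i) //=.
  by rewrite /p' Ai0 measure0 mul0r.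
pose E M := \big[setU/set0]_(J : {set 'I_M.+1} | (counting D M <= L.*2 * #|J|)%N)
  \big[setI/setT]_(i in J) A' i.
have mE M : measurable (E M).
  by apply: bigsetU_measurable => J _; exact: bigsetI_measurable.
have PE M : (P (E M) <= ((3 / 4) ^+ counting D M)%:E)%E.
  apply: le_trans (many_events_bound (p := fun i : 'I_M.+1 => p' i) (a := a)
    (t := 2 ^+ counting D M) _ _ _ _ _ _) _ => //.
  - move=> J; rewrite -big_enum -[in RHS]big_enum /=.
    have := indA' [seq val i | i <- enum J].
    rewrite map_inj_uniq ?enum_uniq; last exact: val_inj.
    by rewrite !big_map => ->.
  - exact: ltW.
  - by move=> J hJ; rewrite -exprM ler_weXn2l // ler1n.
  rewrite lee_fin ler_pdivrMr // -exprMn (_ : 3 / 4 * 2 = 3 / 2 :> R); last by lra.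
  rewrite [in leRHS]/counting expr_sum; apply: ler_prod => i _.
  rewrite addr_ge0 ?mulr_ge0 // ?(ltW a0) //=.
  have [Di|nDi] := boolP (D' i).
    have /andP[-> n1i] := Di; rewrite expr1.
    have := hn1 i n1i (proj1 (andP Di)).
    have := p'E i; rewrite /A' Di => ->; rewrite lee_fin ler_pdivlMr //.
    by lra.
  rewrite /p' /A' (negbTE nDi) measure0 mulr0 addr0.
  by case: (D i) => //=; rewrite expr1; lra.
pose F M := if D M then E M else set0.
have mF M : measurable (F M) by rewrite /F; case: ifP.
have F0 : P (lim_sup_set F) = 0%E.
  apply: lim_sup_set_cvg0 => //; apply: (@le_lt_trans _ _ 3%:E); last exact: ltry.
  apply: lime_le; first exact: is_cvg_nneseries.
  apply: nearW => n; apply: le_trans (_ : _ <= (\sum_(0 <= M < n)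
    (if D M then (3 / 4 : R) ^+ counting D M else 0))%:E)%E _; last first.
    by rewrite lee_fin geometric_counting.
  rewrite -sumEFin; apply: lee_sum => M _; rewrite /F; case: ifP => _.
    exact: PE.
  by rewrite measure0.
exists (lim_sup_set F); split => //.
  by apply: bigcap_measurable => // n _; exact: bigcup_measurable.
move=> w; apply: contra_notP => hw.
have {hw} [n hn] : exists n, forall j, (n <= j)%N -> ~ F j w.
  apply: contrapT => h; apply: hw => n _; apply: contrapT => h'; apply: h.
  by exists n => j nj Fj; apply: h'; exists j.
have [M1 nM1 DM1] := infD n.
pose B i := D' i && (w \in A i).
have hB j : (n <= j)%N -> D j -> (L.*2 * counting B j <= counting D j)%N.
  move=> nj Dj; have := hn j nj; rewrite /F Dj /E -bigcup_seq_cond.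
  apply: contra_notT; rewrite -ltnNge => h.
  exists [set i : 'I_j.+1 | w \in A' i]%SET => /=.
    rewrite mem_index_enum /=; apply: leq_trans (ltnW h) _.
    rewrite leq_mul2l; apply/orP; right.
    rewrite /counting -sum1_card [leqRHS]big_mkcond; apply: leq_sum => i _.
    by rewrite inE /B /A'; case: (D' i) => //=; case: (w \in A i).
  rewrite -bigcap_seq_cond => i /=; rewrite inE => /andP[_].
  by rewrite inE.
(* Induction from an element M1 of D: both counting functions are constant
   off D. *)
have hB' M : (M1 <= M)%N -> (L.*2 * counting B M <= counting D M)%N.
  elim: M => [|M IH] h.
    by move: h; rewrite leqn0 => /eqP h; rewrite -h; apply: hB.
  have [DM|nDM] := boolP (D M.+1); first by apply: hB => //; lia.
  rewrite !countingS /B /D' (negbTE nDM) /= !addn0.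
  by apply: IH; move: h; rewrite leq_eqVlt => /orP[/eqP h|//]; rewrite -h DM1 in nDM.
have [M2 hM2] := counting_infty infD (L.*2 * n1).
exists (maxn M1 M2) => M; rewrite geq_max => /andP[/hB' h2 /hM2 h3].
have h1 : (counting (fun i => D i && (w \in A i)) M <= counting B M + n1)%N.
  by apply: counting_split => i n1i; rewrite /B /D' n1i andbT.
move: h1 h2 h3; rewrite -!mul2n -!mulnA; move: (counting _ M) => b.
move: (counting B M) (counting D M) => b' c h1 h2 h3.
have h4 : (L * b <= L * b' + L * n1)%N by rewrite -mulnDr leq_mul2l h1 orbT.
move: h4 h2 h3; move: (L * b)%N (L * b')%N (L * n1)%N => x y z; lia.
Qed.

(** The second Borel-Cantelli lemma. The divergence of the sum of the
    probabilities is asked for in a block form: arbitrarily far there are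
    finite sets s of indices with a common lower bound u for the probabilities
    and |s| u large. *)
Lemma infinitely_often (D : pred nat) (G : nat -> set T) :
  (forall i, D i -> measurable (G i)) ->
  (forall s : seq nat, uniq s -> (forall i, i \in s -> D i) ->
     P (\big[setI/setT]_(i <- s) ~` G i) = (\prod_(i <- s) P (~` G i))%E) ->
  (forall (m K : nat), exists (s : seq nat) (u : R),
     [/\ uniq s, forall i, i \in s -> D i && (m <= i)%N, 0 <= u,
         forall i, i \in s -> (u%:E <= P (G i))%E
       & K%:R <= (size s)%:R * u]) ->
  {ae P, forall w, forall m, exists N, [/\ (m <= N)%N, D N & G N w]}.
Proof.
move=> mG indG divG; apply: ae_foralln => m.
pose H N := if D N && (m <= N)%N then ~` G N else setT.
have mH N : measurable (H N).
  by rewrite /H; case: ifP => // /andP[DN _]; apply/measurableC/mG.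
exists (\bigcap_N H N); split.
- by apply: bigcap_measurable.
- apply/eqP; rewrite eq_le measure_ge0 andbT.
  have small K : (P (\bigcap_N H N) <= (K.+1%:R^-1)%:E)%E.
    have [s [u [us sD u0 uG Ks]]] := divG m K.+1.
    apply: (@le_trans _ _ (P (\big[setI/setT]_(i <- s) ~` G i))).
      apply: le_measure; rewrite ?inE.
      - exact: bigcap_measurable.
      - rewrite big_seq; apply: bigsetI_measurable => i /sD /andP[Di _].
        exact/measurableC/mG.
      - rewrite -bigcap_seq => w hw i /= si.
        by have := hw i I; rewrite /H sD.
    rewrite indG //; last by move=> i /sD /andP[].
    have mGs i : i \in s -> measurable (G i) by move=> /sD /andP[/mG].
    have pE i : i \in s -> P (~` G i) = (fine (P (~` G i)))%:E.
      by move=> si; rewrite fineK // fin_num_measure //; exact/measurableC/mGs.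
    rewrite big_seq (eq_bigr _ (fun i si => pE i si)) -big_seq prodEFin lee_fin.
    apply: (@le_trans _ _ ((1 - u) ^+ size s)).
      rewrite -(count_predT s) -iter_mulr_1 -big_const_seq.
      rewrite big_seq [leRHS]big_seq; apply: ler_prod => i si.
      rewrite fine_ge0 //= -lee_fin -pE // probability_setC; last exact: mGs.
      by rewrite EFinB leeB ?uG.
    have u1 : u <= 1.
      case: s us sD uG Ks {pE mGs} => [|i s] _ sD uG.
        by rewrite mul0r lern0.
      move=> _; rewrite -lee_fin; apply: le_trans (uG i (mem_head _ _)) _.
      apply: probability_le1.
      by apply: mG; have /andP[] := sD _ (mem_head i s).
    have := pow_one_minus_le (size s) (introT andP (conj u0 u1)).
    rewrite -[X in _ -> _ <= X]mul1r ler_pdivlMr // => h.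
    apply: le_trans h; rewrite ler_wpM2l ?exprn_ge0 ?subr_ge0 //.
    by apply: le_trans Ks _; rewrite lerDr.
  apply/lee_addgt0Pr => e e0; rewrite add0e.
  apply: le_trans (small (Num.trunc e^-1)) _; rewrite lee_fin.
  by rewrite invf_ple ?posrE // ltW // truncnS_gt.
- move=> w /= nw N _; rewrite /H; case: ifP => // /andP[DN mN] GN.
  by apply: nw; exists N.
Qed.

End events.

(** * Cliques of random sum graphs *)

Section model.
Context (R : realType) (d : measure_display) (T : measurableType d)
        (P : probability T R).

(** A graph is determined by the finite set of points where f takes the value 1,
    so the event is a finite union of finite intersections. *)
Lemma measurable_graph_event (N : nat) (f : 'Z_N -> {RV P >-> R})
    (B : set (rel 'Z_N)) :
  measurable [set w | B (random_graph f w)].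
Proof.
pose ind (S : {set 'Z_N}) (x : 'Z_N) : R := (x \in S)%:R.
pose X w := [set x | f x w == 1]%SET.
have graphE w : random_graph f w = sum_graph (ind (X w)).
  apply/funext => x; apply/funext => y; rewrite /random_graph /sum_graph /ind.
  rewrite inE; congr (_ && _); case: (f (x + y) w == 1); rewrite ?eqxx //.
  by rewrite eq_sym oner_eq0.
have -> : [set w | B (random_graph f w)] =
    \bigcup_(S in [set S | B (sum_graph (ind S))])
      \bigcap_(x in [set: 'Z_N])
         (if x \in S then f x @^-1` [set 1] else ~` (f x @^-1` [set 1])).
  apply/seteqP; split => w /=.
    rewrite graphE => Bw; exists (X w) => // x _.
    by rewrite inE; case: eqP.
  move=> [S BS hS]; rewrite graphE (_ : X w = S) //.
  apply/setP => x; rewrite inE; have := hS x I.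
  by case: ifP => _ /= h; apply/eqP.
apply: fin_bigcup_measurable => // S _.
apply: fin_bigcap_measurable => // x _.
have m1 : measurable (f x @^-1` [set 1]) by apply: measurable_funPTI.
by case: ifP => // _; exact: measurableC.
Qed.

(** By multiplicativity f = 1 on [1, Q], and the sum of two distinct elements
    of {0, ..., floor(Q/2)} lies in [1, Q]. Including 0 makes the clique large
    enough to reach Q/2 itself, not just its integer part. *)
Lemma small_primes_positive_clique (N : nat) (Q : R)
    (f : 'Z_N -> {RV P >-> R}) w :
  Qmultiplicative Q f -> (1 < N)%N -> 0 <= Q < N%:R ->
  (forall x : 'Z_N, prime x -> in_1Q Q x -> f x w = 1) ->
  Q / 2 <= (clique_number (random_graph f w))%:R.
Proof.
case: N f => [|[|n]] // f [_ fM _ _] _ /andP[Q0 QN] f1.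
have fz (z : 'Z_n.+2) : in_1Q Q z -> f z w = 1.
  move=> zQ; rewrite fM // big_seq big1 // => p.
  rewrite mem_primes => /and3P[pp z0 pz].
  have lpz := dvdn_leq z0 pz.
  have vp : (p%:R : 'Z_n.+2) = p :> nat.
    by rewrite val_Zp_nat // modn_small //; apply: leq_ltn_trans lpz (ltn_ord z).
  rewrite f1 ?expr1n // ?vp //; rewrite /in_1Q vp prime_gt0 //=.
  by case/andP: zQ => _; apply: le_trans; rewrite ler_nat.
pose m := Num.truncn (Q / 2).
have mQ : m%:R <= Q / 2 by rewrite truncn_le divr_ge0.
have mn : (m.+1 <= n.+2)%N.
  rewrite -(@ltr_nat R); apply: le_lt_trans QN; lra.
pose S : {set 'Z_n.+2} := [set widen_ord mn i | i in [set: 'I_m.+1]]%SET.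
have cS : #|S| = m.+1.
  rewrite card_imset ?cardsT ?card_ord // => i j /(congr1 val) /= ij.
  exact: val_inj.
apply: (@le_trans _ _ m.+1%:R); first exact/ltW/truncnS_gt.
rewrite ler_nat -cS /clique_number.
apply: (leq_bigmax_cond (F := fun S : {set 'Z_n.+2} => #|S|)).
apply/forall_inP => _ /imsetP[i _ ->]; apply/forall_inP => _ /imsetP[j _ ->].
apply/implyP => neq; rewrite /random_graph /sum_graph neq /=; apply/eqP/fz.
have ij : (i != j :> nat) by apply: contra neq => /eqP ij; apply/eqP/val_inj.
have sQ : (i + j)%:R <= Q.
  apply: le_trans (_ : (m.*2)%:R <= Q).
    by rewrite ler_nat; have := ltn_ord i; have := ltn_ord j; lia.
  by rewrite -muln2 natrM; lra.
have sN : (i + j < n.+2)%N by rewrite -(@ltr_nat R); exact: le_lt_trans QN.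
rewrite /in_1Q /= modn_small // sQ andbT; lia.
Qed.

(** The values of f at the primes up to Q are independent signs, and all of
    them are 1 with probability 2^(-pi(Q)). *)
Lemma probability_large_clique (N : nat) (Q : R) (f : 'Z_N -> {RV P >-> R}) :
  Qmultiplicative Q f -> (1 < N)%N -> 0 <= Q < N%:R ->
  (((2^-1) ^+ counting prime (Num.truncn Q))%:E <=
   P [set w | (Q / 2 <= (clique_number (random_graph f w))%:R)%R])%E.
Proof.
move=> fQ N1 QN.
pose s := [seq x : 'Z_N <- enum 'Z_N | prime (x : nat) && in_1Q Q x].
have us : uniq s by rewrite filter_uniq // enum_uniq.
have sE (x : 'Z_N) : (x \in s) = prime (x : nat) && in_1Q Q x.
  by rewrite mem_filter mem_enum andbT.
have free x : x \in s -> free_point Q x.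
  by rewrite sE /free_point => /andP[->]; rewrite orbT.
have Ps : P (\big[setI/setT]_(x <- s) (f x @^-1` [set 1])) = ((2^-1) ^+ size s)%:E.
  rewrite (mutually_independent_seq (Qmult_indep fQ)) //; last first.
    by move=> x _; exists [set 1]; rewrite ?setTI.
  rewrite big_seq (eq_bigr (fun=> (2^-1)%:E)); last first.
    by move=> x xs; have [] := Qmult_uniform fQ (free x xs).
  by rewrite -big_seq prodEFin big_const_seq count_predT iter_mulr_1.
have Q0 := proj1 (andP QN).
have size_s : (size s <= counting prime (Num.truncn Q))%N.
  rewrite countingE -(size_map val); apply: uniq_leq_size.
    by rewrite map_inj_uniq //; exact: val_inj.
  move=> _ /mapP[x xs ->]; rewrite mem_filter mem_iota /= add0n ltnS.
  by move: xs; rewrite sE /in_1Q truncn_ge_nat // => /and3P[-> _ ->].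
apply: (@le_trans _ _ ((2^-1) ^+ size s)%:E).
  by rewrite lee_fin ler_wiXn2l //; lra.
rewrite -Ps; apply: le_measure; rewrite ?inE.
- by apply: bigsetI_measurable => x _; apply: measurable_funPTI.
- exact: (measurable_graph_event f (fun e => Q / 2 <= (clique_number e)%:R)).
- move=> w; rewrite -bigcap_seq => hw /=.
  apply: small_primes_positive_clique => // x px xQ; apply: hw => /=.
  by rewrite sE px.
Qed.

End model.

(** * The size of Q(N) compared with the primes *)

Section log2.
Context (R : realType).
Implicit Types x y c : R.

Lemma ln2_gt0 : 0 < ln 2 :> R.
Proof. by rewrite ln_gt0 // ltr1n. Qed.

Lemma log2_pow n : log2 ((2 ^ n)%:R : R) = n%:R.
Proof.
by rewrite /log2 natrX lnXn // -[ln 2 *+ n]mulr_natl mulfK // gt_eqF // ln2_gt0.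
Qed.

Lemma le_log2 x y : 0 < x -> x <= y -> log2 x <= log2 y.
Proof.
move=> x0 xy; rewrite ler_pM2r ?invr_gt0 ?ln2_gt0 // ler_ln // posrE.
exact: lt_le_trans xy.
Qed.

Lemma log2_ge1 N : (2 <= N)%N -> 1 <= log2 (N%:R : R).
Proof.
move=> N2; rewrite -[leLHS](log2_pow 1); apply: le_log2; first by rewrite ltr0n.
by rewrite ler_nat.
Qed.

Lemma loglog2_ge0 N : (2 <= N)%N -> 0 <= log2 (log2 (N%:R : R)).
Proof.
by move=> N2; rewrite -[leLHS](log2_pow 0); apply: le_log2 => //; exact: log2_ge1.
Qed.

Lemma Qof_ge0 c N : 0 <= c -> (2 <= N)%N -> 0 <= Qof c N.
Proof.
move=> c0 N2; apply: mulr_ge0; last exact: loglog2_ge0.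
by apply: mulr_ge0 => //; exact: le_trans ler01 (log2_ge1 N2).
Qed.

Lemma le_Qof c N M : 0 <= c -> (2 <= N <= M)%N -> Qof c N <= Qof c M.
Proof.
move=> c0 /andP[N2 NM].
have h : log2 (N%:R : R) <= log2 M%:R.
  by apply: le_log2; rewrite ?ler_nat // ltr0n; lia.
have l0 := lt_le_trans ltr01 (log2_ge1 N2).
apply: ler_pM; first by apply: mulr_ge0 => //; exact: ltW.
- exact: loglog2_ge0.
- exact: ler_wpM2l.
- exact: le_log2.
Qed.

Lemma mul_pred_lt_exp2 t : (t * t.-1 < 2 ^ t)%N.
Proof.
case: t => // t; elim: t => [|t IH] //.
have := ltn_expl t.+1 (isT : (1 < 2)%N); move: IH; rewrite /= !expnS; nia.
Qed.

(** With 2^k <= N < 2^(k+1), Q(N) is at most k (k + 1) / 2, which is less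
    than 2^k. *)
Lemma Qof_lt c N : 0 <= c -> c <= 2^-1 -> (2 <= N)%N -> Qof c N < N%:R.
Proof.
move=> c0 c12 N2; set k := trunc_log 2 N.
have /andP[kN Nk] : (2 ^ k <= N < 2 ^ k.+1)%N by apply: trunc_log_bounds; lia.
have l1 := log2_ge1 N2; have ll0 := loglog2_ge0 N2.
have lk : log2 (N%:R : R) <= k.+1%:R.
  by rewrite -[leRHS]log2_pow; apply: le_log2; rewrite ?ltr0n ?ler_nat; lia.
have llk : log2 (log2 (N%:R : R)) <= k%:R.
  rewrite -[leRHS]log2_pow; apply: le_log2; first exact: lt_le_trans l1.
  by apply: le_trans lk _; rewrite ler_nat ltn_expl.
have kk : (k.+1%:R * k%:R < 2 * N%:R :> R).
  rewrite -!natrM ltr_nat; have := mul_pred_lt_exp2 k.+1.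
  by rewrite expnS /=; lia.
rewrite /Qof -mulrA.
have h : log2 (N%:R : R) * log2 (log2 N%:R) <= k.+1%:R * k%:R.
  by apply: ler_pM => //; exact: le_trans ler01 l1.
have h0 : 0 <= log2 (N%:R : R) * log2 (log2 N%:R).
  by rewrite mulr_ge0 //; exact: le_trans ler01 l1.
nra.
Qed.

(** At N = 2^k with k = 2^j one has Q = c k j, and [counting_prime_upper] with
    threshold 2^(j - L) gives pi(Q) <= 2^(-L) k + 2 c k j / (j - L). For L large
    and then j large this is at most (1 - 2e) k where 4e = 1 - 2c, that is
    (1 - 1/r) k for an integer r. *)
Lemma counting_prime_Qof c : 0 < c -> c < 2^-1 ->
  exists r J, (0 < r)%N /\ forall j, (J <= j)%N ->
    (r * counting prime (Num.truncn (Qof c (2 ^ 2 ^ j))) + 2 ^ j <= r * 2 ^ j)%N.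
Proof.
move=> c0 c12; pose e := (1 - 2 * c) / 4.
have e0 : 0 < e by rewrite /e; lra.
pose L := (Num.truncn e^-1).+1.
have Le : (2 ^ L)%:R^-1 <= e.
  rewrite invf_ple ?posrE ?ltr0n ?expn_gt0 //.
  apply: le_trans (ltW (truncnS_gt _)) _; rewrite -/L ler_nat ltnW //.
  exact: ltn_expl.
(* The same L, being at least 1/e, serves as r. *)
exists L, (L.+1 + (Num.truncn (2 * L%:R / e)).+1)%N; split=> // j Jj.
set Q := Qof _ _; set p := counting _ _.
have QE : Q = c * (2 ^ j)%:R * j%:R by rewrite /Q /Qof !log2_pow.
have Q0 : 0 <= Q by rewrite QE !mulr_ge0 // ltW.
have jL : (L < j)%N by apply: leq_trans Jj; rewrite leq_addr.
have je : 2 * L%:R <= e * j%:R.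
  rewrite [leRHS]mulrC -ler_pdivrMr //.
  apply: le_trans (ltW (truncnS_gt _)) _.
  by rewrite ler_nat; apply: leq_trans Jj; rewrite leq_addl.
have up := counting_prime_upper (j - L) (Num.truncn Q); rewrite -/p in up.
have kE : (2 ^ j = 2 ^ L * 2 ^ (j - L))%N by rewrite -expnD subnKC // ltnW.
have pL : (p%:R : R) <= (2 ^ (j - L))%:R + (p - 2 ^ (j - L))%:R.
  by rewrite -natrD ler_nat; lia.
have up' : (j%:R - L%:R) * (p - 2 ^ (j - L))%:R <= 2 * (c * (2 ^ j)%:R * j%:R).
  rewrite -QE -natrB ?(ltnW jL) // -natrM.
  apply: le_trans (_ : (Num.truncn Q).*2%:R <= _); first by rewrite ler_nat.
  by rewrite -mul2n natrM ler_wpM2l // truncn_le.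
have k0 : (0 : R) < (2 ^ j)%:R by rewrite ltr0n expn_gt0.
have jL0 : (0 : R) < j%:R - L%:R by rewrite subr_gt0 ltr_nat.
have small : (2 ^ (j - L))%:R <= e * (2 ^ j)%:R.
  have : (2 ^ (j - L))%:R = (2 ^ L)%:R^-1 * (2 ^ j)%:R :> R.
    by rewrite kE natrM mulKf // pnatr_eq0 expn_eq0.
  by move=> ->; rewrite ler_wpM2r // ltW.
have main : (p - 2 ^ (j - L))%:R <= (2 * c + e) * (2 ^ j)%:R.
  rewrite -(ler_pM2l jL0); apply: le_trans up' _.
  rewrite [leRHS](_ : _ = (2 ^ j)%:R * ((j%:R - L%:R) * (2 * c + e))); last by lra.
  rewrite [leLHS](_ : _ = (2 ^ j)%:R * (2 * c * j%:R)); last by lra.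
  rewrite ler_wpM2l ?(ltW k0) //.
  have L0 : 0 <= (L%:R : R) by [].
  have : (2 * c + e) * L%:R <= 1 * L%:R by rewrite ler_wpM2r // /e; lra.
  nra.
have pe : p%:R <= (1 - 2 * e) * (2 ^ j)%:R.
  apply: le_trans pL _; apply: le_trans (lerD small main) _.
  by rewrite -mulrDl ler_wpM2r ?(ltW k0) // /e; lra.
have eL : 1 <= e * L%:R.
  by rewrite mulrC -ler_pdivrMr // div1r ltW // truncnS_gt.
rewrite -(@ler_nat R) natrD !natrM.
have : L%:R * p%:R <= L%:R * ((1 - 2 * e) * (2 ^ j)%:R) :> R by rewrite ler_wpM2l.
nra.
Qed.

(** With M = 2^k and p = pi(Q(M)), the previous bound reads k <= r t for
    t = k - p, while pi(M) is about 2^k / k = 2^p 2^t / k, at least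
    2^p 2^t / (r t). As t tends to infinity with k, this eventually exceeds any
    multiple of 2^p. *)
Lemma many_primes_versus_Qof c m K : 0 < c -> c < 2^-1 ->
  exists M, (K * 2 ^ counting prime (Num.truncn (Qof c M)) + m
             <= counting prime M)%N.
Proof.
move=> c0 c12; have [r [J [r0 hJ]]] := counting_prime_Qof c0 c12.
(* j is chosen so that t > C, which forces t C <= t (t - 1) < 2^t. *)
pose C := (r * (K + m + 1))%N.
pose j := (J + r * C.+1)%N; exists (2 ^ 2 ^ j)%N.
have := hJ j (leq_addr _ _); set p := counting prime (Num.truncn _) => hp.
have := @counting_prime_lower (2 ^ j); rewrite expn_gt0 => /(_ isT).
set q := counting prime (2 ^ _) => hq.
have jk : (j <= 2 ^ j)%N by rewrite ltnW // ltn_expl.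
move: hp hq jk; set k := (2 ^ j)%N => hp hq jk.
have pk : (p <= k)%N by rewrite -(leq_pmul2l r0); lia.
pose t := (k - p)%N.
have kE : k = (p + t)%N by rewrite subnKC.
have krt : (k <= r * t)%N by move: hp; rewrite {2}kE mulnDr; lia.
have tC : (C.+1 <= t)%N.
  rewrite -(leq_pmul2l r0); apply: leq_trans krt; apply: leq_trans jk.
  by rewrite /j leq_addl.
have t2 : (t * C <= 2 ^ t)%N.
  apply: leq_trans (ltnW (mul_pred_lt_exp2 t)).
  by rewrite leq_mul2l; apply/orP; right; lia.
have P1 : (0 < 2 ^ p)%N by rewrite expn_gt0.
have t0 : (0 < r * t)%N by rewrite muln_gt0 r0; lia.
suff : ((K * 2 ^ p + m).+1 <= q.+1)%N by [].
rewrite -(leq_pmul2l t0).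
apply: leq_trans (_ : 2 ^ k <= _)%N; last first.
  by apply: leq_trans hq _; rewrite leq_mul2r krt orbT.
rewrite kE expnD; apply: leq_trans (_ : 2 ^ p * (t * C) <= _)%N; last first.
  by rewrite leq_mul2l t2 orbT.
rewrite /C.
have : ((K * 2 ^ p + m).+1 <= 2 ^ p * (K + m + 1))%N by nia.
move: (K * 2 ^ p + m).+1 (K + m + 1)%N => x y h.
rewrite (_ : 2 ^ p * (t * (r * y)) = r * t * (2 ^ p * y))%N; last first.
  by move: (2 ^ p)%N => z; lia.
by rewrite leq_mul2l h orbT.
Qed.

End log2.

(** * Density one and the main theorem *)

Lemma prime_countE (A : pred nat) M :
  prime_count A M = counting (fun p => prime p && A p) M.
Proof.
rewrite /prime_count /counting -sum1_card big_mkcond; apply: eq_bigr => i _.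
by rewrite inE; case: (_ && _).
Qed.

Lemma infinitely_many_primes N0 n :
  exists2 N, (n <= N)%N & (N0 <= N)%N && prime N.
Proof.
have [p hp pp] := prime_above (n + N0).
by exists p; [lia | rewrite pp andbT; lia].
Qed.

(** For every L the exceptional primes make up at most 1/L of the primes, and
    the primes below N0 become negligible as well. *)
Lemma density1_of_sparse_complement (R : realType) (N0 : nat) (A B : pred nat) :
  (forall p, (N0 <= p)%N -> prime p -> A p || B p) ->
  (forall L, exists M0, forall M, (M0 <= M)%N ->
     (L * counting (fun p => (N0 <= p)%N && prime p && B p) M <=
      counting (fun p => (N0 <= p)%N && prime p) M)%N) ->
  relative_density_in_primes A (1 : R).
Proof.
move=> AB sparse; apply/cvgrPdist_le => e e0.
pose L := (Num.truncn (2 / e)).+1.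
have [M1 h1] := sparse L.
have infp n : exists2 N, (n <= N)%N & prime N.
  by have [N nN /andP[_ pN]] := infinitely_many_primes 0 n; exists N.
have [M2 h2] := counting_infty infp (L * N0).+1.
exists (maxn M1 M2) => // M /=; rewrite geq_max => /andP[/h1 {}h1 /h2 {}h2].
rewrite !prime_countE.
move: h1 h2; set b := counting _ M; set q0 := counting _ M.
set q := counting prime M; set a := counting _ M; set q' := counting _ M.
have -> : q' = q by apply: eq_bigr => i _; rewrite andbT.
move=> h1 h2.
have q0q : (q0 <= q)%N by apply: leq_sum => i _; case: (N0 <= i)%N.
have aq : (a <= q)%N by apply: leq_sum => i _; case: (prime i); case: (A i).
have qab : (q <= a + b + N0)%N.
  pose AB' p := prime p && (A p || (N0 <= p)%N && B p).
  apply: leq_trans (counting_split (D' := AB') (n := N0) M _) _.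
    by move=> p Np pp; rewrite /AB' pp Np /= AB.
  rewrite leq_add2r /a /b /counting -big_split; apply: leq_sum => i _ /=.
  by rewrite /AB'; case: (prime i); case: (A i); case: (N0 <= i)%N; case: (B i).
have qpos : (0 : R) < q%:R by rewrite ltr0n; lia.
have eL : 2 <= e * L%:R.
  by rewrite [leRHS]mulrC -ler_pdivrMr //; exact/ltW/truncnS_gt.
have Lqa : (L * (q - a) <= 2 * q)%N by nia.
have L0 : (0 : R) < L%:R by rewrite ltr0n.
rewrite ger0_norm; last by rewrite subr_ge0 ler_pdivrMr // mul1r ler_nat.
rewrite -[X in X - _](divff (lt0r_neq0 qpos)) -mulrBl ler_pdivrMr // -natrB //.
rewrite -(ler_pM2l L0); apply: (@le_trans _ _ (2 * q%:R)).
  by rewrite -!natrM ler_nat.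
by rewrite mulrA ler_wpM2r ?(ltW qpos) // mulrC.
Qed.

Theorem theorem1p3 (R : realType) (eps c : R)
    (eps_gt0 : 0 < eps) (c_gt0 : 0 < c) (c_lt_half : c < 2^-1)
    (c_conc : clique_concentration c)
    (d : measure_display) (T : measurableType d) (P : probability T R)
    (N0 : nat) (f : forall N : nat, 'Z_N -> {RV P >-> R})
    (f_Qmult : forall N : nat, (N0 <= N)%N -> prime N ->
       Qmultiplicative (Qof c N) (f N))
    (graphs_indep : mutually_independent P
       [set N : nat | (N0 <= N)%N && prime N]
       (fun N => gen_by_discrete (random_graph (f N)))) :
  {ae P, forall w,
    (forall m : nat, exists N : nat,
       [/\ (m <= N)%N, (N0 <= N)%N, prime N &
           Qof c N / 2 <= (clique_number (random_graph (f N) w))%:R]) /\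
    relative_density_in_primes
      (fun N => [&& (N0 <= N)%N, prime N &
                    clique_near_2log eps (random_graph (f N) w)]) (1 : R)}.
Proof.
pose D N := (N0 <= N)%N && prime N.
have graph_event N (B : set (rel 'Z_N)) :
    gen_by_discrete (random_graph (f N)) [set w | B (random_graph (f N) w)].
  by exists B => //; rewrite setTI.
have indep (A : nat -> set T) (s : seq nat) :
    (forall N, gen_by_discrete (random_graph (f N)) (A N)) ->
    uniq s -> (forall i, i \in s -> D i) ->
    P (\big[setI/setT]_(i <- s) A i) = (\prod_(i <- s) P (A i))%E.
  by move=> genA us sD; apply: (mutually_independent_seq graphs_indep).
pose G N := [set w | Qof c N / 2 <= (clique_number (random_graph (f N) w))%:R].
pose A N := [set w | ~~ clique_near_2log eps (random_graph (f N) w)].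
have io : {ae P, forall w, forall m, exists N, [/\ (m <= N)%N, D N & G N w]}.
  apply: infinitely_often.
  - move=> N _; exact: (measurable_graph_event (f N)
      (fun e => Qof c N / 2 <= (clique_number e)%:R)).
  - move=> s us sD; apply: indep => // N.
    exact: (graph_event N (fun e => ~ (Qof c N / 2 <= (clique_number e)%:R))).
  (* The block of primes from m' to M, all of whose probabilities are at least
     the bound computed at the end point M. *)
  - move=> m K; pose m' := (m + N0 + 2)%N.
    have [M hM] := many_primes_versus_Qof m' K c_gt0 c_lt_half.
    set p := counting prime (Num.truncn _) in hM.
    pose s := [seq N <- iota 0 M.+1 | prime N && (m' <= N)%N].
    have sE N : N \in s -> [/\ prime N, (m' <= N)%N & (N <= M)%N].
      by rewrite mem_filter mem_iota => /andP[/andP[-> ->]].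
    exists s, ((2^-1) ^+ p); split.
    + by rewrite filter_uniq // iota_uniq.
    + by move=> N /sE[pN mN _]; rewrite /D pN andbT; lia.
    + exact: exprn_ge0.
    + move=> N /sE[pN mN NM]; have N2 := prime_gt1 pN.
      have Q0 := Qof_ge0 (ltW c_gt0) N2.
      have := probability_large_clique (f_Qmult N ltac:(lia) pN) N2.
      rewrite Q0 (Qof_lt (ltW c_gt0) (ltW c_lt_half) N2) => /(_ isT).
      apply: le_trans; rewrite lee_fin ler_wiXn2l //; try lra.
      apply: leq_counting; apply: le_truncn; apply: le_Qof; first exact: ltW.
      by rewrite N2.
    + rewrite -countingE -[X in _ * X]/(_ ^+ _) exprVn ler_pdivlMr ?exprn_gt0 //.
      rewrite -natrX -natrM ler_nat.
      have := counting_split (D := prime) (D' := fun N => prime N && (m' <= N)%N)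
        (n := m') M (fun i mi pi => introT andP (conj pi mi)).
      lia.
have small (e : R) : 0 < e -> exists n, forall i, (n <= i)%N -> D i ->
    (P (A i) <= e%:E)%E.
  move=> e0.
  have := c_conc (fun=> d) (fun=> T) (fun=> P) f N0 f_Qmult eps eps_gt0.
  have : ((1 - e)%:E < 1%:E :> \bar R)%E by rewrite lte_fin gtrBl.
  move=> /open_ereal_gt' hn /(_ _ hn)[n _ hN].
  exists n => i ni /andP[_ pi].
  have := hN i ni pi => /=.
  have -> : A i = ~` [set w | clique_near_2log eps (random_graph (f i) w)].
    by apply/seteqP; split => w /= /negP.
  rewrite probability_setC; last first.
    exact: (measurable_graph_event (f i) (fun g => clique_near_2log eps g)).
  move=> h; rewrite leeBlDr ?fin_num_measure //.
    by rewrite -leeBlDl //; apply: ltW; rewrite -EFinB.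
  exact: (measurable_graph_event (f i) (fun g => clique_near_2log eps g)).
have rare L : {ae P, forall w, exists M0, forall M, (M0 <= M)%N ->
    (L * counting (fun i => D i && (w \in A i)) M <= counting D M)%N}.
  apply: rare_events => //.
  - by move=> n; exact: infinitely_many_primes.
  - move=> N _; exact: (measurable_graph_event (f N)
      (fun e => ~~ clique_near_2log eps e)).
  - move=> s us sD; apply: indep => // N.
    exact: (graph_event N (fun e => ~~ clique_near_2log eps e)).
move/ae_foralln : rare => rare; apply: filterS2 io rare => w iow rarew; split.
  by move=> m; have [N [mN /andP[N0N pN] GN]] := iow m; exists N.
apply: (@density1_of_sparse_complement R N0 _ (fun N => w \in A N)) rarew.
move=> N N0N pN; rewrite N0N pN /=; case: (boolP (clique_near_2log _ _)) => //= h.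
by rewrite inE.
Qed.
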